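(* For any conforming mesh $\mathcal M$ of $\Omega$, there exists a sequence $(f_k)_k\subset L^2(\Omega)$ such that $$\frac{\operatorname{osc}_0(f_k,\mathcal M)}{\|\nabla(u_{f_k}-U_{f_k;\mathcal M})\|}\to\infty\qquad\text{as }k\to\infty.$$
   Context: Let $d\in\mathbb N$ and let $\Omega\subset\mathbb R^d$ be open, bounded, connected, with closure that can be subdivided into simplices. $\|\cdot\|$ is the $L^2(\Omega)$-norm. $\mathcal M$ is a simplicial, face-to-face (conforming) mesh of $\Omega$, $h_K=\operatorname{diam}K$ for $K\in\mathcal M$, and $\mathbb V_0(\mathcal M)$ is the space of continuous, $\mathcal M$-piecewise affine functions vanishing on $\partial\Omega$. For $f\in L^2(\Omega)$, $u_f\in H^1_0(\Omega)$ satisfies $\int_\Omega\nabla u_f\cdot\nabla v=\int_\Omega fv$ for all $v\in H^1_0(\Omega)$, and $U_{f;\mathcal M}\in\mathbb V_0(\mathcal M)$ satisfies the same identity for all $v\in\mathbb V_0(\mathcal M)$. The classical $L^2$-oscillation is $\operatorname{osc}_0(f,\mathcal M)=\big(\sum_{K\in\mathcal M}h_K^2\|f-P_{0,\mathcal M}f\|_{L^2(K)}^2\big)^{1/2}$ with $P_{0,\mathcal M}f|_K=\frac1{|K|}\int_Kf$. *)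

(* Defs.v *)
From HB Require Import structures.
From mathcomp Require Import all_boot all_order all_algebra.
From mathcomp Require Import all_classical all_reals all_analysis.
Import Order.TTheory GRing.Theory Num.Theory.
Import numFieldNormedType.Exports.

Set Implicit Arguments.
Unset Strict Implicit.
Unset Printing Implicit Defensive.

Local Open Scope classical_set_scope.
Local Open Scope ring_scope.

Definition rV_display : measure_display. Proof. exact: default_measure_display. Qed.

(* The Borel sigma-algebra of R^n, generated by the coordinate functions (the
   library does the same for n.-tuple T). *)
Section measurable_rV.
Variables (R : realType) (n : nat).

Definition rV_coor (i : 'I_n) (x : 'rV[R]_n) : measurableTypeR R := x ord0 i.

Let rV_set0 : g_sigma_preimage rV_coor set0.
Proof. exact: sigma_algebra0. Qed.

Let rV_setC A : g_sigma_preimage rV_coor A -> g_sigma_preimage rV_coor (~` A).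
Proof. exact: sigma_algebraC. Qed.

Let rV_bigcup (F : (set 'rV[R]_n)^nat) :
  (forall i, g_sigma_preimage rV_coor (F i)) ->
  g_sigma_preimage rV_coor (\bigcup_i (F i)).
Proof. exact: sigma_algebra_bigcup. Qed.

HB.instance Definition _ := @isMeasurable.Build rV_display
  'rV[R]_n (g_sigma_preimage rV_coor) rV_set0 rV_setC rV_bigcup.

Lemma measurable_rV_coor (i : 'I_n) : measurable_fun [set: 'rV[R]_n] (rV_coor i).
Proof.
move=> _ Y mY; rewrite setTI; apply: sub_sigma_algebra => /=.
rewrite -bigcup_seq/=; exists i => /=; first by rewrite mem_index_enum.
by exists Y => //; rewrite setTI.
Qed.

Lemma measurable_fun_rVP d (T : measurableType d) (f : T -> 'rV[R]_n) :
  (forall i, measurable_fun [set: T] (rV_coor i \o f)) ->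
  measurable_fun [set: T] f.
Proof.
move=> mf.
pose g i := rV_coor i \o f.
have : g_sigma_preimage g `<=` measurable.
  apply: smallest_sub; first exact: sigma_algebra_measurable.
  have {}mf : forall i, measurable_fun [set: T] (g i) by exact: mf.
  move: g mf; case: n => [|m] g mf; first by rewrite big_ord0.
  rewrite -bigcup_mkord_ord; apply: bigcup_sub => i Ii.
  by move=> A [B mB <-]; exact: mf.
rewrite g_sigma_preimage_comp => prefS _ A mA.
by apply: prefS; exists A.
Qed.

End measurable_rV.

Section lebesgue_rV.
Variable R : realType.
Local Open Scope ereal_scope.

Definition rV_cons n (p : measurableTypeR R * 'rV[R]_n) : 'rV[R]_n.+1 :=
  row_mx (p.1)%:M p.2.

(* n-dimensional Lebesgue measure on Borel sets, as an iterated product; see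
   lebesgue_rV_box below. *)
Fixpoint lebesgue_rV n : set 'rV[R]_n -> \bar R :=
  match n with
  | 0%N => \d_(0%R : 'rV[R]_0)
  | m.+1 => pushforward (lebesgue_measure \x @lebesgue_rV m) (@rV_cons m)
  end.

Lemma measurable_rV_cons n : measurable_fun [set: _] (@rV_cons n).
Proof.
apply: measurable_fun_rVP => i.
have [i1 | i0] := eqVneq i ord0.
  rewrite (_ : _ \o _ = fst) ?i1; first exact: measurable_fst.
  apply/funext => p /=; rewrite /rV_coor /rV_cons mxE.
  by case: splitP => j // _; rewrite (ord1 j) mxE eqxx mulr1n.
have [j ij] : exists j : 'I_n, i = rshift 1 j.
  by case: (unliftP ord0 i) i0 => [j -> _|->]; [exists j; apply/val_inj | rewrite eqxx].
rewrite (_ : _ \o _ = rV_coor j \o snd).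
  by apply: measurableT_comp; [exact: measurable_rV_coor|exact: measurable_snd].
by apply/funext => p /=; rewrite /rV_coor /rV_cons ij; exact: (@row_mxEr R 1 1 n).
Qed.

Let rV_uncons n (v : 'rV[R]_n.+1) : measurableTypeR R * 'rV[R]_n :=
  (rV_coor ord0 v, @rsubmx _ 1 1 n v).

Let measurable_rV_uncons n : measurable_fun [set: _] (@rV_uncons n).
Proof.
apply/measurable_fun_pairP; split; first exact: measurable_rV_coor.
apply: measurable_fun_rVP => i.
rewrite (_ : _ \o _ = rV_coor (rshift 1 i)); first exact: measurable_rV_coor.
by apply/funext => v /=; rewrite /rV_coor mxE.
Qed.

Let rV_consK n : cancel (@rV_cons n) (@rV_uncons n).
Proof.
case=> x v; rewrite /rV_uncons /rV_cons row_mxKr; congr pair.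
by rewrite /rV_coor mxE; case: splitP => j // _; rewrite (ord1 j) mxE eqxx mulr1n.
Qed.

Let lebesgue_rV_sfm n :
  exists m : {sigma_finite_measure set 'rV[R]_n -> \bar R},
    (m : set _ -> _) = @lebesgue_rV n.
Proof.
elim: n => [|n [m mE]]; first by exists \d_(0%R : 'rV[R]_0).
have mc := @measurable_rV_cons n.
have [mu muE] : exists mu : set 'rV[R]_n.+1 -> \bar R,
  mu = pushforward (lebesgue_measure \x m) (@rV_cons n) by eexists.
have mu0 : mu set0 = 0 by rewrite muE; exact: measure0.
have mu_ge0 A : 0 <= mu A by rewrite muE; exact: measure_ge0.
have mu_add : semi_sigma_additive mu.
  by rewrite muE; exact: measure_semi_sigma_additive.
pose muM := isMeasure.Build _ _ _ mu mu0 mu_ge0 mu_add.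
pose mu1 : {measure set _ -> \bar R} := HB.pack mu muM.
have muT : sigma_finite setT mu.
  have [G TG Gfin] := sigma_finiteT (@lebesgue_measure R).
  have /sigma_finiteP[H [TH ndH Hfin]] := sigma_finiteT m.
  have /sigma_finiteP[F [TF ndF Ffin]] : sigma_finite setT (@lebesgue_measure R).
    by exists G.
  exists (fun i => @rV_uncons n @^-1` (F i `*` H i)).
    rewrite -preimage_bigcup; apply/esym/seteqP; split => // v _ /=.
    have [i _ Fi] : (\bigcup_i F i) (rV_uncons v).1 by rewrite -TF.
    have [j _ Hj] : (\bigcup_i H i) (rV_uncons v).2 by rewrite -TH.
    exists (maxn i j) => //; split.
      by apply: (subsetPset _ _ (ndF _ _ (leq_maxl i j))).
    by apply: (subsetPset _ _ (ndH _ _ (leq_maxr i j))).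
  move=> i; have [mF Foo] := Ffin i; have [mH Hoo] := Hfin i; split.
    rewrite -[X in measurable X]setTI; apply: measurable_rV_uncons => //.
    exact: measurableX.
  rewrite muE /pushforward -comp_preimage (_ : _ \o _ = id) ?preimage_id.
    by rewrite product_measure1E// lte_mul_pinfty// ge0_fin_numE.
  by apply/funext => p /=; rewrite rV_consK.
pose muS := Measure_isSigmaFinite.Build _ _ _ mu1 muT.
pose mu2 : {sigma_finite_measure set _ -> \bar R} := HB.pack mu muM muS.
by exists mu2; rewrite /= muE -mE.
Qed.

Section instances.
Variable n : nat.

Let lebesgue_rV0 : @lebesgue_rV n set0 = 0.
Proof. by have [m <-] := lebesgue_rV_sfm n; exact: measure0. Qed.

Let lebesgue_rV_ge0 (A : set 'rV[R]_n) : 0 <= lebesgue_rV A.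
Proof. by have [m <-] := lebesgue_rV_sfm n; exact: measure_ge0. Qed.

Let lebesgue_rV_sigma_additive : semi_sigma_additive (@lebesgue_rV n).
Proof.
by have [m <-] := lebesgue_rV_sfm n; exact: measure_semi_sigma_additive.
Qed.

HB.instance Definition _ := isMeasure.Build _ _ _ (@lebesgue_rV n)
  lebesgue_rV0 lebesgue_rV_ge0 lebesgue_rV_sigma_additive.

Let lebesgue_rV_sigma_finite : sigma_finite setT (@lebesgue_rV n).
Proof. by have [m <-] := lebesgue_rV_sfm n; exact: sigma_finiteT. Qed.

HB.instance Definition _ := Measure_isSigmaFinite.Build _ _ _ (@lebesgue_rV n)
  lebesgue_rV_sigma_finite.

End instances.

Lemma lebesgue_rV_box n (a b : 'rV[R]_n) : (forall i, (a ord0 i <= b ord0 i)%R) ->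
  lebesgue_rV [set x : 'rV[R]_n | forall i, a ord0 i < x ord0 i <= b ord0 i]%R =
  (\prod_(i < n) (b ord0 i - a ord0 i)%R)%:E.
Proof.
elim: n a b => [|n IH] a b ab.
  by rewrite big_ord0 /= diracE mem_set// => -[].
pose ta : 'rV[R]_n := \row_i a ord0 (lift ord0 i).
pose tb : 'rV[R]_n := \row_i b ord0 (lift ord0 i).
have tab i : (ta ord0 i <= tb ord0 i)%R by rewrite !mxE.
have cons0 (x : measurableTypeR R) (v : 'rV[R]_n) : rV_cons (x, v) ord0 ord0 = x.
  exact: (congr1 fst (rV_consK (x, v))).
have consS (x : measurableTypeR R) (v : 'rV[R]_n) (i : 'I_n) : rV_cons (x, v) ord0 (lift ord0 i) = v ord0 i.
  have -> : lift ord0 i = @rshift 1 n i by exact: val_inj.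
  exact: (@row_mxEr R 1 1 n).
have E : @rV_cons n @^-1` [set x | forall i, a ord0 i < x ord0 i <= b ord0 i]%R =
    ([set` `]a ord0 ord0, b ord0 ord0]] : set (measurableTypeR R)) `*`
    [set x : 'rV[R]_n | forall i, ta ord0 i < x ord0 i <= tb ord0 i]%R.
  apply/seteqP; split => -[x v] /= => [h|[/= h0 h] i].
    split; first by have := h ord0; rewrite cons0 in_itv.
    by move=> i /=; have := h (lift ord0 i); rewrite consS !mxE.
  have [->|[j ->]] : i = ord0 \/ exists j, i = lift ord0 j.
  - by case: (unliftP ord0 i) => [j|] ->; [right; exists j|left].
  - by rewrite cons0; move: h0; rewrite in_itv.
  - by rewrite consS; have := h j; rewrite !mxE.
rewrite /= /pushforward E.
have mbox : measurable [set x : 'rV[R]_n |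
    forall i, ta ord0 i < x ord0 i <= tb ord0 i]%R.
  rewrite (_ : [set _ | _] = \bigcap_(i in [set: 'I_n])
      (rV_coor i @^-1` [set` `]ta ord0 i, tb ord0 i]])).
    apply: fin_bigcap_measurable => // i _; rewrite -[X in measurable X]setTI.
    exact: measurable_rV_coor.
  apply/seteqP; split => v /= h i; first by move=> _; rewrite /= in_itv; exact: h.
  by have := h i I; rewrite /= in_itv.
rewrite product_measure1E//= IH// lebesgue_measure_itv/= lte_fin.
rewrite big_ord_recl EFinM; congr (_ * _).
  have [//|ba] := ltP (a ord0 ord0) (b ord0 ord0).
  by have -> : a ord0 ord0 = b ord0 ord0; [apply/eqP; rewrite eq_le ab ba|rewrite subrr].
by congr EFin; apply: eq_bigr => i _; rewrite !mxE.
Qed.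
End lebesgue_rV.

Section functions_on_a_domain.
Variables (R : realType) (d : nat).
Implicit Types (Omega A K F : set 'rV[R]_d) (v u f phi : 'rV[R]_d -> R).
Implicit Types (g : 'rV[R]_d -> 'rV[R]_d) (x y : 'rV[R]_d).

Local Notation mu := (@lebesgue_rV R d).

Definition dotrv x y : R := \sum_(i < d) x ord0 i * y ord0 i.

Definition in_L2 A v : Prop := v \_ A \in Lfun mu 2%:E.

Definition vec_in_L2 A g : Prop := forall i, in_L2 A (fun x => g x ord0 i).

Definition L2norm A v : R := Num.sqrt (\int[mu]_(x in A) (v x ^+ 2)).

Definition vec_L2norm A g : R := Num.sqrt (\int[mu]_(x in A) dotrv (g x) (g x)).

Definition partial (i : 'I_d) phi : 'rV[R]_d -> R :=
  fun x => 'D_(delta_mx ord0 i) phi x.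

Definition grad phi : 'rV[R]_d -> 'rV[R]_d := fun x => \row_i partial i phi x.

(* C^oo: all iterated partial derivatives exist and are continuous. *)
Definition smooth phi : Prop := forall s : seq 'I_d,
  let psi := foldr partial phi s in
  continuous psi /\ forall x i, derivable psi x (delta_mx ord0 i).

Definition supp phi : set 'rV[R]_d := closure [set x | phi x != 0].

(* C_c^oo(Omega) *)
Definition test_function Omega phi : Prop :=
  [/\ smooth phi, compact (supp phi) & supp phi `<=` Omega].

(* v is in H^1(Omega) and g is a representative of its weak gradient. *)
Definition H1 Omega v g : Prop :=
  [/\ in_L2 Omega v, vec_in_L2 Omega g &
   forall phi (i : 'I_d), test_function Omega phi ->
     \int[mu]_(x in Omega) (v x * partial i phi x) =
     - \int[mu]_(x in Omega) (g x ord0 i * phi x)].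

(* H^1_0(Omega) is the closure of C_c^oo(Omega) in H^1(Omega); g is again the
   weak gradient of v. *)
Definition H10 Omega v g : Prop :=
  H1 Omega v g /\
  exists phi : nat -> 'rV[R]_d -> R,
    [/\ forall n, test_function Omega (phi n),
        L2norm Omega (v \- phi n) @[n --> \oo] --> 0 &
        vec_L2norm Omega (g \- grad (phi n)) @[n --> \oo] --> 0].

(* The weak gradient is a.e. unique; it is carried along as an explicit
   representative gu. *)
Definition weak_solution Omega f u gu : Prop :=
  H10 Omega u gu /\
  forall v gv, H10 Omega v gv ->
    \int[mu]_(x in Omega) dotrv (gu x) (gv x) =
    \int[mu]_(x in Omega) (f x * v x).

Definition hull (z : 'I_d.+1 -> 'rV[R]_d) (S : set 'I_d.+1) : set 'rV[R]_d :=
  [set x | exists w : 'I_d.+1 -> R,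
    [/\ forall i, 0 <= w i, forall i, ~ S i -> w i = 0,
        \sum_i w i = 1 & x = \sum_i w i *: z i]].

Definition affinely_independent (z : 'I_d.+1 -> 'rV[R]_d) : Prop :=
  forall c : 'I_d.+1 -> R, \sum_i c i = 0 -> \sum_i c i *: z i = 0 ->
    forall i, c i = 0.

Definition simplex K : Prop :=
  exists2 z, affinely_independent z & K = hull z setT.

(* Faces of all dimensions, including the empty face (S = set0) *)
Definition face F K : Prop :=
  exists z S, [/\ affinely_independent z, K = hull z setT & F = hull z S].

Definition conforming_mesh Omega (M : set (set 'rV[R]_d)) : Prop :=
  [/\ finite_set M, forall K, M K -> simplex K,
      \bigcup_(K in M) K = closure Omega &
      forall K K', M K -> M K' -> face (K `&` K') K /\ face (K `&` K') K'].

Definition V0 Omega (M : set (set 'rV[R]_d)) v : Prop :=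
  [/\ {within closure Omega, continuous v},
      forall K, M K -> exists a b, forall x, K x -> v x = dotrv a x + b &
      forall x, (closure Omega `\` Omega°) x -> v x = 0].

Definition galerkin_solution Omega M f U gU : Prop :=
  [/\ V0 Omega M U, H1 Omega U gU &
   forall v gv, V0 Omega M v -> H1 Omega v gv ->
     \int[mu]_(x in Omega) dotrv (gU x) (gv x) =
     \int[mu]_(x in Omega) (f x * v x)].

(* Euclidean diameter (the norm of 'rV[R]_d in the library is the max norm) *)
Definition diam K : R :=
  sup [set Num.sqrt (dotrv (x - y) (x - y)) | x in K & y in K].

Definition mean A f : R := (\int[mu]_(x in A) f x) / fine (mu A).

(* Elements are subsets of the closure of Omega while f is only meaningful on
   Omega, hence the integrals over K `&` Omega. *)
Definition osc0 Omega (M : set (set 'rV[R]_d)) f : R :=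
  Num.sqrt (\sum_(K \in M)
    diam K ^+ 2 *
      L2norm (K `&` Omega) (fun x => f x - mean (K `&` Omega) f) ^+ 2).

End functions_on_a_domain.

(* Main.v *)
(* The oscillation is an L2 quantity while the error is an H^{-1} quantity, so f
   may concentrate.  Take a small box of radius e inside the interior of some
   element K, a smooth bump phi supported in it, and f := - Laplacian phi.  Then
   u_f = phi, and U_f = 0 because two integrations by parts show that f is
   orthogonal to functions that are affine on K.  For the same reason f has mean
   0 on K, so osc_0(f) >= diam K * ||Laplacian phi||, and the error is
   ||grad phi||.  By Poincare's inequality ||phi|| <= 2 e ||grad phi||, hence
   ||grad phi||^2 = (- Laplacian phi, phi) gives
   ||grad phi|| <= 2 e ||Laplacian phi||; let e tend to 0. *)
Require Import Defs.
From mathcomp Require Import all_boot all_order all_algebra.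
From mathcomp Require Import all_classical all_reals all_analysis.
From mathcomp Require Import measurable_realfun ring lra.
Import Order.TTheory GRing.Theory Num.Theory.
Import numFieldNormedType.Exports.

Set Implicit Arguments.
Unset Strict Implicit.
Unset Printing Implicit Defensive.

Local Open Scope classical_set_scope.
Local Open Scope ring_scope.

(** * Integration on R^n *)

Section measure.
Variable R : realType.

(** The functions [u], [U] and their weak gradients are arbitrary representatives that satisfy the
    variational identities, and gradients are fixed only almost everywhere. The error is therefore
    not found by substituting phi and 0: its norm is expanded into L2 products, and testing the
    identities determines each of these. Since phi vanishes off a cube inside K and Omega, its
    integrals against continuous functions are integrals over the whole space. The divergence
    theorem is used only in the form that a partial derivative of a function vanishing off a cube
    integrates to 0, which is Fubini and the fundamental theorem of calculus on a line; no trace or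
    normal ever appears. The blow-up rate comes from the Poincare constant being linear in e,
    uniformly over all functions supported in the cube. The ratio is homogeneous in f, so the bumps
    for different e share no profile or scaling; positivity at the centre is their only
    normalisation, and it keeps the error away from 0. *)

Lemma rV_ballP n (x y : 'rV[R]_n) e :
  ball x e y <-> 0 < e /\ forall i, `|x ord0 i - y ord0 i| < e.
Proof.
split=> [[e0 h]|[e0 h]]; split => //.
  by move=> i; exact: h.
by move=> i j; rewrite (ord1 i); exact: h.
Qed.

Lemma continuous_rV n (T : topologicalType) (f : T -> 'rV[R]_n) :
  (forall i, continuous (fun x => f x ord0 i)) -> continuous f.
Proof.
move=> h x; apply/cvg_ballP => e e0.
have : \forall y \near x, forall i, ball (f x ord0 i) e (f y ord0 i).
  by apply: filter_forall => i; have /cvg_ballP := h i x; exact.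
by apply: filterS => y hy; apply/rV_ballP; split.
Qed.

(** The sigma-algebra is generated by coordinates, so [A] has to be a countable union of boxes:
    those with rational centre and radius 1/(k+1) that lie in [A]. *)
Lemma open_measurable_rV n (A : set 'rV[R]_n) : open A -> measurable A.
Proof.
move=> oA.
pose B (qk : 'rV[rat]_n * nat) : set 'rV[R]_n :=
  [set x | forall i, `|x ord0 i - ratr (qk.1 ord0 i)| < qk.2.+1%:R^-1].
have mB qk : measurable (B qk).
  rewrite (_ : B qk = \bigcap_(i in [set: 'I_n]) (rV_coor i @^-1`
      [set` `]ratr (qk.1 ord0 i) - qk.2.+1%:R^-1, ratr (qk.1 ord0 i) + qk.2.+1%:R^-1[])).
    apply: fin_bigcap_measurable => // i _; rewrite -[X in measurable X]setTI.
    exact: measurable_rV_coor.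
  apply/seteqP; split => v /= h i; first by move=> _; rewrite /= in_itv/= -ltr_distl;
    exact: h.
  by have := h i I; rewrite /= in_itv /= -ltr_distl.
rewrite (_ : A = \bigcup_(qk in [set qk | B qk `<=` A]) B qk); last first.
  apply/seteqP; split; last by move=> x [qk] /= sub /sub.
  move=> x Ax.
  have /nbhs_ballP[e /= e0 sub] : nbhs x A by exact: open_nbhs_nbhs.
  (* Half of [e], because a point of the box reaches x through the rational centre, at a cost of
     1/(k+1) twice. *)
  have [k ke] : exists k : nat, k.+1%:R^-1 < e / 2.
    have [k] := ltr_add_invr (divr_gt0 e0 (ltr0n R 2)).
    by rewrite add0r => ke; exists k.
  have /(_ _)/cid h i : exists q : rat, `|x ord0 i - ratr q| < k.+1%:R^-1.
    have : x ord0 i - k.+1%:R^-1 < x ord0 i + k.+1%:R^-1 by rewrite ltrD2l gtrN // invr_gt0.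
    by case/rat_in_itvoo => q; rewrite in_itv /= => qP; exists q; rewrite distrC ltr_distl.
  exists (\row_i sval (h i), k); last by move=> i /=; rewrite mxE; case: (h i).
  move=> y By /=; apply: sub; apply/rV_ballP; split => // i.
  have := By i; rewrite /= mxE; case: (h i) => q /= qx qy.
  rewrite (le_lt_trans (ler_distD (ratr q) _ _))// [e]splitr ltrD//.
    exact: lt_trans ke.
  by rewrite distrC; exact: lt_trans ke.
rewrite bigcup_mkcond; apply: countable_bigcupT_measurable; first exact: countableP.
by move=> qk; case: ifP.
Qed.

Lemma continuous_measurable_rV n (f : 'rV[R]_n -> R) :
  continuous f -> measurable_fun [set: 'rV[R]_n] f.
Proof.
move=> cf; apply: (measurability _ (RGenOInfty.measurableE R)).
move=> _ [_ [a ->] <-]; rewrite setTI; apply: open_measurable_rV.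
by move/continuousP : cf; apply; exact: rray_open.
Qed.

Definition cbox n (a : 'rV[R]_n) (e : R) : set 'rV[R]_n :=
  [set x | forall i, `|x ord0 i - a ord0 i| <= e].

Lemma cbox_compact n (a : 'rV[R]_n) e : compact (cbox a e).
Proof.
rewrite (_ : cbox a e = [set v | forall i, `[a ord0 i - e, a ord0 i + e]%classic
  (v ord0 i)]).
  by apply: (@rV_compact R n (fun i => `[a ord0 i - e, a ord0 i + e]%classic)) => i;
    exact: segment_compact.
apply/seteqP; split => v /= h i; first by rewrite in_itv /= -ler_distl.
by have := h i; rewrite in_itv /= -ler_distl.
Qed.

Lemma cbox_closed n (a : 'rV[R]_n) e : closed (cbox a e).
Proof. by apply: compact_closed; [exact: norm_hausdorff|exact: cbox_compact]. Qed.

Lemma measurable_cbox n (a : 'rV[R]_n) e : measurable (cbox a e).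
Proof.
rewrite -[cbox a e]setCK; apply: measurableC.
by apply: open_measurable_rV; rewrite openC; exact: cbox_closed.
Qed.

Lemma measurable_ocbox n (l u : 'rV[R]_n) :
  measurable [set x : 'rV[R]_n | forall i, l ord0 i < x ord0 i <= u ord0 i].
Proof.
rewrite (_ : [set x | _] = \bigcap_(i in [set: 'I_n])
    (rV_coor i @^-1` [set` `]l ord0 i, u ord0 i]])).
  apply: fin_bigcap_measurable => // i _; rewrite -[X in measurable X]setTI.
  exact: measurable_rV_coor.
apply/seteqP; split => v /= h i; first by move=> _; rewrite /= in_itv; exact: h.
by have := h i I; rewrite /= in_itv.
Qed.

Lemma lebesgue_cbox_fin n (a : 'rV[R]_n) e : (lebesgue_rV (cbox a e) < +oo)%E.
Proof.
(* [lebesgue_rV_box] measures half-open boxes with ordered corners: the -1 makes the left inequality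
   strict, and the absolute value covers a negative [e]. *)
pose l : 'rV[R]_n := \row_i (a ord0 i - `|e| - 1).
pose u : 'rV[R]_n := \row_i (a ord0 i + `|e|).
pose B := [set x : 'rV[R]_n | forall i, l ord0 i < x ord0 i <= u ord0 i].
have mB : measurable B := measurable_ocbox l u.
apply: (@le_lt_trans _ _ (lebesgue_rV B)); last first.
  by rewrite lebesgue_rV_box ?ltry// => i; rewrite !mxE; have := normr_ge0 e; lra.
apply: le_measure; rewrite ?inE//; first exact: measurable_cbox.
by move=> x xe i; have := xe i; rewrite !mxE ler_distl; have := ler_norm e; lra.
Qed.

(** A directional derivative depends only on the increments along its line. This moves derivatives
    between a function on R^n and its restriction to a line or a slice. *)
Lemma is_derive_growth (V W Y : normedModType R) (f : V -> Y) (g : W -> Y) a v b w df :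
  (forall h : R, f (h *: v + a) - f a = g (h *: w + b) - g b) ->
  is_derive b w g df -> is_derive a v f df.
Proof.
move=> fg.
have E : (fun h : R => h^-1 *: ((f \o shift a) (h *: v) - f a)) =
         (fun h => h^-1 *: ((g \o shift b) (h *: w) - g b)).
  by apply/funext => h /=; rewrite fg.
by case=> dg1 dg2; split; rewrite /derivable /derive E.
Qed.

Lemma integral_derive1 (F f : R -> R) (M : R) :
  (forall x : R, is_derive x 1 F (f x)) -> continuous f ->
  (forall x, M < `|x| -> F x = 0) -> (forall x, M < `|x| -> f x = 0) ->
  (\int[lebesgue_measure]_x (f x)%:E = 0)%E.
Proof.
move=> dF cf F0 f0.
(* [M] may be negative; [N] is positive and exceeds [M], so [F] vanishes at both ends of [-N, N]. *)
pose N : R := `|M| + 1.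
have N0 : 0 < N by rewrite ltr_pwDr.
have MN : M < N by rewrite (le_lt_trans (ler_norm M))// ltrDl.
have cF : continuous F.
  by move=> x; apply/differentiable_continuous/derivable1_diffP; exact: ex_derive.
transitivity (\int[lebesgue_measure]_(x in `[(- N)%R, N]) (f x)%:E)%E.
  rewrite [RHS]integral_mkcond; apply: eq_integral => x _; rewrite /patch.
  case: ifPn => // /negP xN; rewrite f0//.
  apply: (lt_trans MN); rewrite ltNge; apply/negP => xN'; apply: xN.
  by rewrite inE/= in_itv/= -ler_norml.
rewrite (@continuous_FTC2 _ f F (- N) N)//.
- rewrite !F0 ?normrN ?gtr0_norm// ?subee//.
- by lra.
- exact: continuous_subspaceT.
- split.
  + by move=> x _; exact: ex_derive.
  + by apply: cvg_at_right_filter; exact: cF.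
  + by apply: cvg_at_left_filter; exact: cF.
- by move=> x _; rewrite derive1E; exact: derive_val.
Qed.

Lemma bounded_integrable d (T : measurableType d) (mu : {measure set T -> \bar R})
    (D : set T) (f : T -> R) (C : R) :
  measurable D -> (mu D < +oo)%E -> measurable_fun setT f ->
  (forall x, `|f x| <= C) -> (forall x, ~ D x -> f x = 0) ->
  mu.-integrable setT (EFin \o f).
Proof.
move=> mD muD mf fC f0.
rewrite (_ : EFin \o f = (EFin \o f) \_ D); last first.
  apply/funext => x; rewrite /patch; case: ifPn => // /negP xD.
  by rewrite /= f0// => Dx; apply: xD; rewrite inE.
apply/(integrable_mkcond _ mD).1; apply: measurable_bounded_integrable => //.
  exact: measurable_funTS.
exists C; split; first exact: num_real.
by move=> M CM x _ /=; exact: le_trans (ltW CM).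
Qed.

Lemma continuous_bounded_integrable n (a : 'rV[R]_n) e (f : 'rV[R]_n -> R) (C : R) :
  continuous f -> (forall x, `|f x| <= C) -> (forall x, ~ cbox a e x -> f x = 0) ->
  (@lebesgue_rV R n).-integrable setT (EFin \o f).
Proof.
move=> cf; apply: bounded_integrable; first exact: (measurable_cbox a e).
  exact: lebesgue_cbox_fin.
exact: continuous_measurable_rV.
Qed.

Lemma rV_cons0 n (t : measurableTypeR R) (v : 'rV[R]_n) : rV_cons (t, v) ord0 ord0 = t.
Proof. by rewrite /rV_cons mxE; case: splitP => j // _;
  rewrite (ord1 j) mxE eqxx mulr1n. Qed.

Lemma rV_consS n (t : measurableTypeR R) (v : 'rV[R]_n) (i : 'I_n) :
  rV_cons (t, v) ord0 (lift ord0 i) = v ord0 i.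
Proof.
have -> : lift ord0 i = @rshift 1 n i by exact: val_inj.
exact: (@row_mxEr R 1 1 n).
Qed.

Lemma rV_consP n (x : 'rV[R]_n.+1) (t : measurableTypeR R) (v : 'rV[R]_n) :
  x ord0 ord0 = t -> (forall i, x ord0 (lift ord0 i) = v ord0 i) -> x = rV_cons (t, v).
Proof.
move=> x0 xS; apply/rowP => i; case: (unliftP ord0 i) => [j|] ->.
  by rewrite xS rV_consS.
by rewrite x0 rV_cons0.
Qed.

(** Fubini splits off the first coordinate. If [i] is that coordinate, the inner integral is
    one-dimensional and vanishes by the fundamental theorem of calculus; otherwise the inner
    integral runs over the other coordinates and vanishes by induction. Centring the cube at 0 lets
    the support condition pass to slices with the same [M]; the bound [C] gives the integrability
    that Fubini asks for. *)
Lemma integral_partial n (i : 'I_n) (F f : 'rV[R]_n -> R) (M C : R) :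
  (forall x, is_derive x (delta_mx ord0 i) F (f x)) -> continuous f ->
  (forall x, `|f x| <= C) ->
  (forall x, ~ cbox 0 M x -> F x = 0) -> (forall x, ~ cbox 0 M x -> f x = 0) ->
  (\int[@lebesgue_rV R n]_x (f x)%:E = 0)%E.
Proof.
elim: n i F f => [[]//|n IH] i F f dF cf fC F0 f0.
have mf := continuous_measurable_rV cf.
have mc := @measurable_rV_cons R n.
pose mu2 := (@lebesgue_measure R \x @lebesgue_rV R n)%E.
have intf : mu2.-integrable setT ((EFin \o f) \o @rV_cons R n).
  apply: (@bounded_integrable _ _ mu2 (@rV_cons R n @^-1` cbox 0 M)
    (f \o @rV_cons R n) C) => //.
  - rewrite -[X in measurable X]setTI; apply: mc => //; exact: measurable_cbox.
  - exact: (lebesgue_cbox_fin (0 : 'rV[R]_n.+1) M).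
  - exact: measurableT_comp.
  - by move=> x; exact: fC.
  - by move=> x /= /f0.
have -> : (\int[@lebesgue_rV R n.+1]_x (f x)%:E = \int[mu2]_z (f (rV_cons z))%:E)%E.
  rewrite -(integral_pushforward mc (mu := mu2) (D := setT) (f := EFin \o f))//.
  exact/measurable_EFinP.
have cons_far (t : measurableTypeR R) v : ~ cbox 0 M v -> ~ cbox 0 M (rV_cons (t, v)).
  by move=> h1 h2; apply: h1 => j; have := h2 (lift ord0 j); rewrite rV_consS !mxE.
have cons_far0 (t : measurableTypeR R) (v : 'rV[R]_n) : M < `|t| ->
  ~ cbox 0 M (rV_cons (t, v)).
  by move=> tM /(_ ord0); rewrite rV_cons0 mxE subr0 leNgt tM.
case: (unliftP ord0 i) => [j|] ij; rewrite {i}ij in dF.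
- rewrite -(integral12_prod_meas1 intf); apply: integral0_eq => t _.
  apply: (IH j (fun v => F (rV_cons (t, v)))) => //.
  + move=> v;
      apply: (@is_derive_growth _ _ _ _ F _ _ (rV_cons (t, v)) (delta_mx ord0 (lift ord0 j))).
      move=> h; congr (F _ - _); apply/esym/rV_consP => [|k]; rewrite mxE.
        by rewrite rV_cons0 !mxE mulr0 add0r.
      by rewrite rV_consS !mxE (inj_eq lift_inj).
  + move=> v; apply: continuous_comp; last exact: cf.
    apply: continuous_rV v => k; case: (unliftP ord0 k) => [k'|] ->.
      by under eq_fun do rewrite rV_consS; exact: coord_continuous.
    by under eq_fun do rewrite rV_cons0; exact: cst_continuous.
  + by move=> v /cons_far/F0.
  + by move=> v /cons_far/f0.
- rewrite -(integral21_prod_meas1 intf); apply: integral0_eq => v _.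
  apply: (@integral_derive1 (fun t => F (rV_cons (t, v))) _ M) => //.
  + move=> t;
      apply: (@is_derive_growth _ _ _ _ F _ _ (rV_cons (t, v)) (delta_mx ord0 ord0)).
      move=> h; congr (F _ - _); apply/esym/rV_consP => [|k]; rewrite mxE.
        by rewrite rV_cons0 !mxE.
      by rewrite rV_consS !mxE mulr0 add0r.
  + move=> t; apply: continuous_comp; last exact: cf.
    apply: continuous_rV t => k; case: (unliftP ord0 k) => [k'|] ->.
      by under eq_fun do rewrite rV_consS; exact: cst_continuous.
    by under eq_fun do rewrite rV_cons0; move=> x; exact: cvg_id.
  + by move=> t /cons_far0 h; rewrite F0.
  + by move=> t /cons_far0 h; rewrite f0.
Qed.

End measure.

(** * Smooth bump functions *)

Section smooth_real.
Variable R : realType.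
Implicit Types f g : R -> R.

(** C^n regularity with the derivative as an existential witness, so that each closure property can
    name the derivative it produces. *)
Fixpoint Cn (n : nat) (f : R -> R) : Prop :=
  if n is m.+1 then exists2 g, forall x : R, is_derive x 1 f (g x) & Cn m g
  else continuous f.

Lemma is_derive_continuous f g : (forall x : R, is_derive x 1 f (g x)) -> continuous f.
Proof.
by move=> dF x; apply/differentiable_continuous/derivable1_diffP; exact: ex_derive.
Qed.

(** Serves the product rule, in which both factors reappear undifferentiated at the lower order. *)
Lemma CnW n f : Cn n.+1 f -> Cn n f.
Proof.
elim: n f => [|n IH] f [g dg Cg] /=; first exact: is_derive_continuous dg.
by exists g => //; exact: IH.
Qed.

Lemma Cn_cst n (c : R) : Cn n (fun=> c).
Proof.
elim: n c => [|n IH] c /=; first exact: cst_continuous.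
by exists (fun=> 0) => // x; exact: is_derive_cst.
Qed.

Lemma CnD n f g : Cn n f -> Cn n g -> Cn n (fun x => f x + g x).
Proof.
elim: n f g => [|n IH] f g /=.
  by move=> cf cg x; apply: cvgD; [exact: cf|exact: cg].
move=> [f' df Cf] [g' dg Cg]; exists (fun x => f' x + g' x); last exact: IH.
by move=> x; apply: is_deriveD.
Qed.

Lemma CnM n f g : Cn n f -> Cn n g -> Cn n (fun x => f x * g x).
Proof.
elim: n f g => [|n IH] f g.
  by move=> cf cg x; apply: cvgM; [exact: cf|exact: cg].
move=> Cf Cg; have [Cf0 Cg0] := (CnW Cf, CnW Cg).
case: Cf Cg => [f' df Cf] [g' dg Cg]; exists (fun x => f x * g' x + g x * f' x).
  by move=> x; apply: is_deriveM.
by apply: CnD; exact: IH.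
Qed.

Lemma Cn_affine n f (a b : R) : Cn n f -> Cn n (fun x => f (a * x + b)).
Proof.
have daff (x : R) : is_derive x 1 (fun x : R => a * x + b) a.
  have -> : (fun x : R => a * x + b) = (a \*: id) \+ cst b :> (R -> R) by [].
  by apply: is_derive_eq; rewrite addr0 /GRing.scale/= mulr1.
elim: n f => [|n IH] f.
  move=> cf x; apply: continuous_comp; last exact: cf.
  exact: (is_derive_continuous daff).
move=> [f' df Cf]; exists (fun x => f' (a * x + b) * a).
  by move=> x; apply: (@is_derive1_comp _ f (fun x => a * x + b)).
by apply: CnM; [exact: IH|exact: Cn_cst].
Qed.

(* The span of these functions is closed under differentiation. *)
Definition flat k (t : R) : R := if 0 < t then t^-1 ^+ k * expR (- t^-1) else 0.

(** One term of the exponential series suffices: exp y >= y^(k+2) / (k+2)! at y = 1/t. *)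
Lemma flat_le k t : `|flat k t| <= k.+2`!%:R * t ^+ 2.
Proof.
rewrite /flat; case: ifPn => [t0|_]; last by rewrite normr0 mulr_ge0// sqr_ge0.
rewrite ger0_norm ?mulr_ge0 ?exprn_ge0 ?invr_ge0 ?(ltW t0) ?expR_ge0//.
rewrite expRN -ler_pdivlMr ?invr_gt0 ?expR_gt0// invrK.
have y0 : 0 <= t^-1 by rewrite invr_ge0 ltW.
have := expR_ge1Dxn k.+1 y0; set E := expR _ => hE.
have : t^-1 ^+ k.+2 / k.+2`!%:R <= E by apply: le_trans hE; rewrite lerDr.
rewrite ler_pdivrMr ?ltr0n ?fact_gt0// => h.
have -> : t^-1 ^+ k = t^-1 ^+ k.+2 * t ^+ 2.
  by rewrite -addn2 exprD -mulrA -exprMn mulVf ?gt_eqF// expr1n mulr1.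
by rewrite [leRHS]mulrAC ler_pM2r ?exprn_gt0// mulrC.
Qed.

Lemma flat0 k : flat k 0 = 0.
Proof. by rewrite /flat ltxx. Qed.

Lemma flat_cvg0 k : flat k z @[z --> (0 : R)] --> (0 : R).
Proof.
apply/cvgr0Pnorm_le => e e0.
have C0 : 0 < k.+2`!%:R :> R by rewrite ltr0n fact_gt0.
have Ce : 0 < k.+2`!%:R^-1 * e by rewrite mulr_gt0 ?invr_gt0.
apply: filterS2 (@nbhs0_le R R _ ltr01) (@nbhs0_le R R _ Ce) => z z1 ze.
rewrite (le_trans (flat_le _ _))// -ler_pdivlMl// -real_normK ?num_real// expr2.
exact: (le_trans (ler_piMl _ z1)).
Qed.

Lemma flat_derive k (t : R) :
  is_derive t 1 (flat k) (flat k.+2 t - k%:R * flat k.+1 t).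
Proof.
case: (ltgtP 0 t) => [t0|t0|<-].
- apply: (@near_eq_is_derive _ _ _ (fun s => (fun s : R => s^-1) s ^+ k * expR (- s^-1))).
    near=> s; rewrite /flat ifT//; near: s; exact: lt_nbhsr.
  have t0' : t != 0 by rewrite gt_eqF.
  have dV : is_derive t 1 (fun s : R => s^-1) (- t ^- 2).
    by apply: (is_derive_eq (is_deriveV t0' (is_derive_id _ _)));
      rewrite /GRing.scale/= mulr1.
  have dE : is_derive t 1 (fun s : R => expR (- s^-1)) (expR (- t^-1) * t ^- 2).
    apply: (@is_derive1_comp _ expR (fun s : R => - s^-1)).
    by apply: (is_derive_eq (is_deriveN dV)); rewrite opprK.
  have dX : is_derive t 1 (fun s : R => s^-1 ^+ k) ((k%:R * t^-1 ^+ k.-1) *: - t ^- 2).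
    have := is_deriveX k dV; congr is_derive.
    by apply/funext => s; elim: (k) => [|m IH]; rewrite ?expr0// !exprS -IH.
  apply: (is_derive_eq (is_deriveM dX dE)).
  rewrite /flat t0 /GRing.scale/=; case: k dX => [|k] _.
    rewrite !expr0 mul0r !mul0r subr0; rewrite exprVn; ring.
  by rewrite -exprVn /= !exprS; ring.
- apply: (@near_eq_is_derive _ _ _ (fun=> 0)).
    near=> s; rewrite /flat ifF//; apply/negbTE; rewrite -leNgt ltW//.
    near: s; exact: lt_nbhsl.
  by rewrite /flat ltNge ltW//= mulr0 subr0; exact: is_derive_cst.
(* At 0 the slope [flat k z / z] is [flat k.+1 z] itself, which tends to 0. *)
- apply/is_derive1_caratheodory; exists (flat k.+1); split.
  + move=> z; rewrite /flat ltxx !subr0; case: ifPn => z0; last by rewrite mul0r.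
    by rewrite exprS; field; rewrite gt_eqF.
  + by have := @flat_cvg0 k.+1; rewrite -[X in _ --> X](flat0 k.+1).
  + by rewrite /flat ltxx mulr0 subr0.
Unshelve. all: by end_near.
Qed.

Lemma Cn_flat n k : Cn n (flat k).
Proof.
elim: n k => [|n IH] k; first exact: is_derive_continuous (flat_derive k).
exists (fun t => flat k.+2 t + - k%:R * flat k.+1 t).
  by move=> t; rewrite mulNr; exact: flat_derive.
by apply: CnD; first exact: IH; apply: CnM; [exact: Cn_cst|exact: IH].
Qed.

Definition smooth1 f : Prop := forall n, Cn n f.

Lemma smooth1_derive f : smooth1 f ->
  (forall x : R, is_derive x 1 f (f^`()%classic x)) /\ smooth1 f^`()%classic.
Proof.
move=> sf; have [g dg _] := sf 1%N.
have fg h : (forall x : R, is_derive x 1 f (h x)) -> f^`()%classic = h.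
  by move=> dh; apply/funext => x; rewrite derive1E; exact: derive_val.
split=> [x|n]; first by rewrite (fg g).
by have [h dh Ch] := sf n.+1; rewrite (fg h).
Qed.

(** On (-1, 1) this is exp(-2 / (1 - t^2)), the standard mollifier profile; the arguments have the
    shape expected by [Cn_affine]. *)
Definition bump1 (t : R) : R := flat 0 (1 * t + 1) * flat 0 (-1 * t + 1).

Lemma smooth1_bump1 : smooth1 bump1.
Proof. by move=> n; apply: CnM; apply: Cn_affine; exact: Cn_flat. Qed.

Lemma bump1_0 : 0 < bump1 0.
Proof. by rewrite /bump1 /flat !mulr0 add0r ltr01 mulr_gt0// mul1r expR_gt0. Qed.

Lemma bump1_out t : 1 <= `|t| -> bump1 t = 0.
Proof.
rewrite ler_normr /bump1 /flat => /orP[t1|t1].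
  by rewrite mulrC ifF ?mul0r//; apply/negbTE; rewrite -leNgt; lra.
by rewrite ifF ?mul0r//; apply/negbTE; rewrite -leNgt; lra.
Qed.

End smooth_real.

Section tensor.
Variables (R : realType) (d : nat).
Implicit Types (g : 'I_d -> R -> R) (x : 'rV[R]_d).

Definition tensor g x : R := \prod_i g i (x ord0 i).

Lemma tensor_derive g j x (dg : R) : is_derive (x ord0 j) 1 (g j) dg ->
  is_derive x (delta_mx ord0 j) (tensor g) (dg * \prod_(i | i != j) g i (x ord0 i)).
Proof.
move=> dgj; set P := \prod_(i | _) _.
apply: (@is_derive_growth _ _ _ _ _ (fun t => g j t * P) _ _ (x ord0 j) 1).
  move=> h; rewrite /tensor (bigD1 j)//= [X in _ - X](bigD1 j)//= -/P !mxE !eqxx.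
  congr (_ * _ - _).
  by apply: eq_bigr => i ij; rewrite !mxE (negbTE ij) mulr0 add0r.
apply: (is_derive_eq (is_deriveM dgj (is_derive_cst P (x ord0 j) 1))).
by rewrite scaler0 add0r /GRing.scale/= mulrC.
Qed.

Lemma partial_tensor g j : (forall i, smooth1 (g i)) ->
  partial j (tensor g) = tensor (fun i => if i == j then (g i)^`()%classic else g i).
Proof.
move=> sg; apply/funext => x; have [dg _] := smooth1_derive (sg j).
have D := tensor_derive (dg (x ord0 j)).
rewrite /partial (@derive_val _ _ _ _ _ _ _ D) /tensor [RHS](bigD1 j)//= eqxx;
  congr (_ * _).
by apply: eq_bigr => i /negbTE ->.
Qed.

Lemma continuous_tensor g : (forall i, continuous (g i)) -> continuous (tensor g).
Proof.
move=> cg; apply: continuous_big => [|i _ x]; first exact: mul_continuous.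
by apply: continuous_comp; [exact: coord_continuous|exact: cg].
Qed.

(** A partial derivative of a product of one-variable functions is again such a product, with one
    factor differentiated, so iterated partials never leave this class. *)
Lemma smooth_tensor g : (forall i, smooth1 (g i)) -> smooth (tensor g).
Proof.
move=> + s; suff H : forall g, (forall i, smooth1 (g i)) ->
    exists2 g', foldr (@partial R d) (tensor g) s = tensor g' & forall i, smooth1 (g' i).
  move=> /H[g' -> sg']; split.
    by apply: continuous_tensor => i; exact: (sg' i 0%N).
  move=> x i; have [dg _] := smooth1_derive (sg' i).
  exact: (@ex_derive _ _ _ _ _ _ _ (tensor_derive (dg _))).
elim: s => [|i s IH] {}g sg; first by exists g.
have [g' /= -> sg'] := IH _ sg; rewrite partial_tensor//; eexists; first by [].
by move=> k /=; case: ifPn => _//; exact: (smooth1_derive (sg' k)).2.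
Qed.

Lemma exists_bump (a : 'rV[R]_d) (e : R) : 0 < e ->
  exists phi : 'rV[R]_d -> R,
    [/\ smooth phi, 0 < phi a & forall x, ~ cbox a e x -> phi x = 0].
Proof.
move=> e0; exists (tensor (fun i t => bump1 (e^-1 * t + - (e^-1 * a ord0 i)))); split.
- by apply: smooth_tensor => i n; apply: Cn_affine; exact: smooth1_bump1.
- by apply: prodr_gt0 => i _; rewrite subrr bump1_0.
- move=> x /existsNP[i xi]; rewrite /tensor (bigD1 i)//= bump1_out ?mul0r//.
  rewrite -mulrBr normrM gtr0_norm ?invr_gt0// ler_pdivlMl// mulr1 ltW// ltNge.
  exact/negP.
Qed.
End tensor.

(** * Geometry of the mesh *)

Section geometry.
Variables (R : realType) (d : nat).
Implicit Types (Omega K : set 'rV[R]_d) (x y a : 'rV[R]_d).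

(** The points with strictly positive barycentric coordinates form an open set, as these coordinates
    are continuous, and it contains the barycentre. *)
Lemma simplex_interior K : simplex K ->
  exists O : set 'rV[R]_d, [/\ open O, O !=set0 & O `<=` K].
Proof.
move=> [z zi ->].
(* [Z] has rows [(1, z i)], so [(1, x) Z^-1] lists the barycentric coordinates of x. *)
pose Z : 'M[R]_d.+1 := \matrix_(i, j) rV_cons (1, z i) ord0 j.
have ZE (c : 'rV[R]_d.+1) :
    c *m Z = rV_cons (\sum_i c ord0 i, \sum_i c ord0 i *: z i).
  apply/rV_consP => [|j]; rewrite mxE ?summxE; apply: eq_bigr => i _.
    by rewrite mxE rV_cons0 mulr1.
  by rewrite [in LHS]mxE rV_consS mxE.
have Zu : Z \in unitmx.
  (* A row vector in the left kernel of [Z] is an affine dependence between the vertices. *)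
  rewrite -row_free_unit; apply: inj_row_free => c cZ0.
  have h := ZE c; rewrite cZ0 in h.
  apply/rowP => i; rewrite mxE; apply: (zi (fun i => c ord0 i)).
    by have := congr1 (fun v : 'rV[R]_d.+1 => v ord0 ord0) h; rewrite rV_cons0 mxE.
  apply/rowP => j; have := congr1 (fun v : 'rV[R]_d.+1 => v ord0 (lift ord0 j)) h.
  by rewrite rV_consS => <-; rewrite !mxE.
pose w x : 'rV[R]_d.+1 := rV_cons (1, x) *m invmx Z.
have wZ x : w x *m Z = rV_cons (1, x) by rewrite /w mulmxKV.
have cw i : continuous (fun x => w x ord0 i).
  under eq_fun do rewrite mxE.
  apply: continuous_big => [|j _ x]; first exact: add_continuous.
  have cj : continuous (fun x => rV_cons ((1 : measurableTypeR R), x) ord0 j).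
    case: (unliftP ord0 j) => [k|] ->.
      by under eq_fun do rewrite rV_consS; exact: coord_continuous.
    by under eq_fun do rewrite rV_cons0; exact: cst_continuous.
  by have := cvgM (cj x) (@cvg_cst _ (invmx Z j i) _ (nbhs x) _); apply.
exists [set x | forall i, 0 < w x ord0 i]; split.
- rewrite openE => x /= wx.
  have : \forall y \near x, forall i, 0 < w y ord0 i.
    have FF := nbhs_filter x; apply: (@filter_forall _ _ _ _ FF) => i.
    exact: (cvgr_gt _ (cw i x)).
  exact.
- pose c : 'rV[R]_d.+1 := \row_i d.+1%:R^-1.
  exists (\sum_i c ord0 i *: z i) => i.
  have -> : w (\sum_i c ord0 i *: z i) = c.
    rewrite /w -[RHS](mulmxK Zu) ZE; congr (rV_cons (_, _) *m _).
    under eq_bigr do rewrite mxE.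
    by rewrite sumr_const card_ord -[RHS]mulr_natr mulVf ?pnatr_eq0.
  by rewrite mxE invr_gt0.
- move=> x /= wx; exists (fun i => w x ord0 i); split => //.
  + by move=> i; exact: ltW.
  + by move=> i /(_ I).
  + have := congr1 (fun v : 'rV[R]_d.+1 => v ord0 ord0) (etrans (esym (ZE (w x))) (wZ x)).
    by rewrite !rV_cons0.
  + apply/rowP => j;
      have := congr1 (fun v : 'rV[R]_d.+1 => v ord0 (lift ord0 j)) (etrans (esym (ZE (w x))) (wZ x)).
    by rewrite !rV_consS.
Qed.

(** Elements are known to lie only in the closure of [Omega]; but an open set that contains a point
    of this closure meets [Omega] itself, which leaves room for a cube. *)
Lemma mesh_interior Omega M : open Omega -> Omega !=set0 -> conforming_mesh Omega M ->
  exists K a (r : R), [/\ M K, 0 < r & cbox a r `<=` K `&` Omega].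
Proof.
move=> oO [x0 Ox0] [_ Msimp MO _].
have [K MK Kx0] : (\bigcup_(K in M) K) x0 by rewrite MO; exact: subset_closure.
have [U [oU [b Ub] UK]] := simplex_interior (Msimp _ MK).
have : closure Omega b by rewrite -MO; exists K => //; exact: UK.
move=> /(_ U); case; first exact: open_nbhs_nbhs.
move=> y [Oy Uy].
have /nbhs_ballP[e /= e0 sub] : nbhs y (Omega `&` U).
  by apply: open_nbhs_nbhs; split => //; exact: openI.
exists K, y, (e / 2); split => //; first by rewrite divr_gt0.
move=> z zy; have [] : (Omega `&` U) z.
  apply: sub; apply/rV_ballP; split => // i; rewrite distrC (le_lt_trans (zy i))//.
  by rewrite gtr_pMr// invf_lt1// ltr1n.
by move=> ? /UK.
Qed.

Lemma bounded_cbox Omega : bounded_set Omega -> exists B : R, Omega `<=` cbox 0 B.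
Proof.
move=> [B [_ hB]]; exists (B + 1) => x Ox i.
rewrite mxE subr0; apply: le_trans (hB _ _ _ Ox); last by rewrite ltrDl.
have /mapP[j Hj ->] : `|x ord0 i| \in [seq `|x j.1 j.2| | j : 'I_1 * 'I_d].
  by apply/mapP; exists (ord0, i) => //=; rewrite mem_enum.
by rewrite [leRHS]/Num.Def.normr /= mx_normrE; apply/bigmax_geP; right => /=; exists j.
Qed.

Lemma diam_gt0 K a (r B : R) : (0 < d)%N -> 0 < r -> cbox a r `<=` K ->
  K `<=` cbox 0 B -> 0 < diam K.
Proof.
move=> d0 r0 aK KB; pose i0 := Ordinal d0.
pose x := a + r *: delta_mx ord0 i0.
have Kx : K x.
  apply: aK => i; rewrite !mxE addrAC subrr add0r eqxx /=.
  by case: (i == i0); rewrite ?mulr1 ?mulr0 ?normr0 ?gtr0_norm// ltW.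
have Ka : K a by apply: aK => i; rewrite subrr normr0 ltW.
have : 0 < Num.sqrt (dotrv (x - a) (x - a)).
  rewrite sqrtr_gt0 /dotrv (bigD1 i0)//= ltr_pwDl//.
    by rewrite !mxE !eqxx mulr1 addrAC subrr add0r mulr_gt0.
  by apply: sumr_ge0 => i _; rewrite -expr2 sqr_ge0.
move=> /lt_le_trans; apply; apply: ub_le_sup; last by exists x => //; exists a.
(* The supremum dominates its elements only if the distances are bounded; two points of the cube of
   radius [B] differ by at most 2B in each coordinate. *)
exists (Num.sqrt (\sum_(i < d) (B + B) ^+ 2)) => _ [u Ku [v Kv <-]].
apply: ler_wsqrtr; apply: ler_sum => i _; rewrite -expr2 -real_normK ?num_real//.
rewrite lerXn2r ?nnegrE//; have := KB _ Ku i; have := KB _ Kv i;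
  rewrite !mxE !subr0 => h1 h2; first by rewrite addr_ge0// (le_trans _ h1).
by rewrite (le_trans (ler_normB _ _))// lerD.
Qed.

End geometry.

(** * Integration by parts and the Poincare inequality *)

Section Rintegral_sum.
Context d (T : measurableType d) (R : realType) (mu : {measure set T -> \bar R}).
Variables (D : set T) (mD : measurable D).

Lemma integrable_Rsum (I : Type) (s : seq I) (f : I -> T -> R) :
  (forall i, mu.-integrable D (EFin \o f i)) ->
  mu.-integrable D (EFin \o (fun x => \sum_(i <- s) f i x)).
Proof.
move=> intf; rewrite (_ : _ \o _ = fun x => (\sum_(i <- s) (f i x)%:E)%E).
  by apply: integrable_sum => // i _; exact: intf.
by apply/funext => x /=; rewrite sumEFin.
Qed.

Lemma Rintegral_sum (I : Type) (s : seq I) (f : I -> T -> R) :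
  (forall i, mu.-integrable D (EFin \o f i)) ->
  \int[mu]_(x in D) (\sum_(i <- s) f i x) = \sum_(i <- s) \int[mu]_(x in D) f i x.
Proof.
move=> intf; elim: s => [|i s IH].
  rewrite big_nil -[RHS](mul0r (fine (mu D))) -Rintegral_cst//.
  by apply: eq_Rintegral => x _; rewrite big_nil.
rewrite big_cons -IH -RintegralD//; last exact: integrable_Rsum.
by apply: eq_Rintegral => x _; rewrite big_cons.
Qed.

End Rintegral_sum.

Section supported.
Variables (R : realType) (d : nat).
Implicit Types (A : set 'rV[R]_d) (g h F f : 'rV[R]_d -> R) (a : 'rV[R]_d) (e : R).
Local Notation mu := (@lebesgue_rV R d).

(** Yields integrability and square integrability at once, survives multiplication by any continuous
    function, and turns an integral over any set containing the cube into one over the whole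
    space. *)
Definition supported a e g := continuous g /\ forall x, ~ cbox a e x -> g x = 0.

Lemma supportedM_l a e g h : supported a e g -> continuous h -> supported a e (g \* h).
Proof.
move=> [cg g0] ch; split; last by move=> x /g0 /= ->; rewrite mul0r.
by move=> x; have := cvgM (cg x) (ch x); apply.
Qed.

Lemma supportedM_r a e g h : supported a e g -> continuous h -> supported a e (h \* g).
Proof.
move=> sg ch; rewrite (_ : h \* g = g \* h); first exact: supportedM_l.
by apply/funext => x /=; rewrite mulrC.
Qed.

Lemma supportedD a e g h : supported a e g -> supported a e h -> supported a e (g \+ h).
Proof.
move=> [cg g0] [ch h0]; split=> [x|x xB].
  by have := cvgD (cg x) (ch x); apply.
by rewrite /= g0// h0// addr0.
Qed.

Lemma supportedZ a e g (c : R) : supported a e g -> supported a e (fun x => c * g x).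
Proof. by move=> sg; apply: (supportedM_r sg); exact: cst_continuous. Qed.

Lemma supported_sum a e (I : Type) (s : seq I) (g : I -> 'rV[R]_d -> R) :
  (forall i, supported a e (g i)) -> supported a e (fun x => \sum_(i <- s) g i x).
Proof.
move=> sg; split.
  by apply: continuous_big => [|i _]; [exact: add_continuous|exact: (sg i).1].
by move=> x xB; rewrite big1// => i _; rewrite (sg i).2.
Qed.

Lemma supported_bounded a e g : supported a e g -> exists C : R, forall x, `|g x| <= C.
Proof.
move=> [cg g0].
have : compact (g @` cbox a e).
  by apply: continuous_compact; [exact: continuous_subspaceT|exact: cbox_compact].
move=> /compact_bounded[M [_ hM]]; exists (`|M| + 1) => x.
have [xB|xB] := pselect (cbox a e x); last by rewrite g0// normr0 addr_ge0.
by apply: hM; [rewrite (le_lt_trans (ler_norm M))// ltrDl|exists x].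
Qed.

Lemma supported_integrable a e g : supported a e g -> mu.-integrable setT (EFin \o g).
Proof.
move=> sg; have [C hC] := supported_bounded sg.
exact: (continuous_bounded_integrable sg.1 hC sg.2).
Qed.

Lemma supported_restrict a e g A : supported a e g -> cbox a e `<=` A -> g \_ A = g.
Proof.
move=> [_ g0] BA; apply/funext => x; rewrite /patch; case: ifPn => // /negP xA.
by rewrite g0// => /BA xA'; apply: xA; rewrite inE.
Qed.

Lemma Rintegral_supported a e g A : supported a e g -> cbox a e `<=` A ->
  \int[mu]_(x in A) g x = \int[mu]_x g x.
Proof. by move=> sg BA; rewrite Rintegral_mkcond (supported_restrict sg BA). Qed.

Lemma supported_Lfun2 a e g : supported a e g -> g \in Lfun mu 2%:E.
Proof.
move=> sg; rewrite inE; apply/andP; split; rewrite inE/=.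
  exact: continuous_measurable_rV sg.1.
rewrite /finite_norm unlock /= poweR_lty//.
have /integrable_lty := supported_integrable (supportedM_l sg sg.1).
move=> /(_ measurableT); congr (_ < _)%E; apply: eq_integral => x _ /=.
by rewrite powR_mulrn// real_normK ?num_real.
Qed.

Lemma supported_in_L2 a e g A : supported a e g -> cbox a e `<=` A -> in_L2 A g.
Proof. by move=> sg BA; rewrite /in_L2 (supported_restrict sg BA);
  exact: supported_Lfun2 sg. Qed.

Lemma Rintegral_partial a e (i : 'I_d) F f : supported a e F -> supported a e f ->
  (forall x, is_derive x (delta_mx ord0 i) F (f x)) -> \int[mu]_x f x = 0.
Proof.
move=> [cF F0] sf dF; have [C hC] := supported_bounded sf.
(* Large enough for the cube around 0 to contain the one around [a]. *)
pose M := \sum_j `|a ord0 j| + e.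
have out x : ~ cbox 0 M x -> ~ cbox a e x.
  move=> xM xB; apply: xM => j; rewrite mxE subr0.
  rewrite -(subrK (a ord0 j) (x ord0 j)) addrC (le_trans (ler_normD _ _))// lerD//.
  by rewrite (bigD1 j)//= lerDl sumr_ge0.
rewrite /Rintegral (@integral_partial R d i F f M C)//; first exact: sf.1.
  by move=> x /out /F0.
by move=> x /out /sf.2.
Qed.

Lemma in_L2_mul_integrable A (u v : 'rV[R]_d -> R) : measurable A ->
  in_L2 A u -> in_L2 A v -> mu.-integrable A (EFin \o (u \* v)).
Proof.
move=> mA uL vL; apply/integrable_mkcond => //.
have /Lfun1_integrable := Lfun2_mul_Lfun1 uL vL; congr (mu.-integrable _ _).
apply/funext => x /=; rewrite /patch; case: ifPn => //= _; by rewrite mulr0.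
Qed.

End supported.

Section smooth.
Variables (R : realType) (d : nat).
Implicit Types (A Omega K : set 'rV[R]_d) (phi psi v : 'rV[R]_d -> R).
Implicit Types (a c : 'rV[R]_d) (e b : R).
Local Notation mu := (@lebesgue_rV R d).

Lemma smooth_continuous phi : smooth phi -> continuous phi.
Proof. by move=> /(_ [::])[]. Qed.

Lemma smooth_is_derive phi x i : smooth phi ->
  is_derive x (delta_mx ord0 i) phi (partial i phi x).
Proof. by move=> /(_ [::])[_ dphi]; split=> //; exact: dphi. Qed.

Lemma smooth_partial phi i : smooth phi -> smooth (partial i phi).
Proof. by move=> sphi s; have := sphi (rcons s i); rewrite foldr_rcons. Qed.

Lemma supported_partial a e phi i : smooth phi -> supported a e phi ->
  supported a e (partial i phi).
Proof.
move=> sphi [_ phi0]; split; first exact/smooth_continuous/smooth_partial.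
move=> x xB; rewrite /partial (@near_eq_derive _ _ _ _ (cst 0)).
  exact: derive_cst.
have : nbhs x (~` cbox a e).
  by apply: open_nbhs_nbhs; split => //; rewrite openC; exact: cbox_closed.
by apply: filterS => y /phi0.
Qed.

Lemma supported_test_function a e phi Omega : smooth phi -> supported a e phi ->
  cbox a e `<=` Omega -> test_function Omega phi.
Proof.
move=> sphi [_ phi0] BO.
have sB : supp phi `<=` cbox a e.
  rewrite /supp [X in _ `<=` X]((closure_id _).1 (@cbox_closed R d a e)).
  apply: closureS => x /= phix; apply: contrapT => /phi0 phix0.
  by rewrite phix0 eqxx in phix.
split=> //; last exact: subset_trans BO.
by apply: subclosed_compact sB; [exact: closed_closure|exact: cbox_compact].
Qed.

Lemma Rintegral_by_parts a e i phi psi : smooth phi -> supported a e phi -> smooth psi ->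
  \int[mu]_x (phi x * partial i psi x) = - \int[mu]_x (partial i phi x * psi x).
Proof.
move=> sphi Sphi spsi; apply/eqP; rewrite -addr_eq0; apply/eqP.
have cpsi := smooth_continuous spsi.
have S1 : supported a e (phi \* partial i psi).
  by apply: supportedM_l => //; exact/smooth_continuous/smooth_partial.
have S2 : supported a e (partial i phi \* psi).
  by apply: supportedM_l => //; exact: supported_partial.
rewrite -RintegralD//; [|exact: (supported_integrable S1)|exact: (supported_integrable S2)].
apply: (@Rintegral_partial R d a e i (phi \* psi)
  (phi \* partial i psi \+ partial i phi \* psi)).
- exact: supportedM_l.
- exact: supportedD.
move=> x; apply: (is_derive_eq (is_deriveM (smooth_is_derive x i sphi)
  (smooth_is_derive x i spsi))).
by rewrite /GRing.scale/= [X in _ + X]mulrC.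
Qed.

Definition lap phi (x : 'rV[R]_d) : R := \sum_i partial i (partial i phi) x.

Lemma supported_lap a e phi : smooth phi -> supported a e phi -> supported a e (lap phi).
Proof.
move=> sphi Sphi; apply: supported_sum => i.
by do 2 (apply: supported_partial => //; try exact: smooth_partial).
Qed.

Lemma supported_oplap a e phi : smooth phi -> supported a e phi ->
  supported a e (fun x => - lap phi x).
Proof.
move=> sphi Sphi; under eq_fun do rewrite -mulN1r.
by apply: supportedZ; exact: supported_lap.
Qed.

Lemma H1_supported a e phi Omega : smooth phi -> supported a e phi -> cbox a e `<=` Omega ->
  H1 Omega phi (grad phi).
Proof.
move=> sphi Sphi BO; split.
- exact: supported_in_L2 BO.
- move=> i; rewrite (_ : (fun _ => _) = partial i phi); last first.
    by apply/funext => x; rewrite mxE.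
  exact: (supported_in_L2 (supported_partial i sphi Sphi)).
move=> psi i [spsi _ _].
have cpsi := smooth_continuous spsi.
rewrite (@Rintegral_supported _ _ a e (phi \* partial i psi))//; last first.
  by apply: supportedM_l => //; exact/smooth_continuous/smooth_partial.
rewrite (Rintegral_by_parts i sphi Sphi)//; congr (- _).
under [in RHS]eq_Rintegral do rewrite mxE.
rewrite [RHS](@Rintegral_supported _ _ a e (partial i phi \* psi))//.
exact: (supportedM_l (supported_partial i sphi Sphi) cpsi).
Qed.

Lemma H10_supported a e phi Omega : smooth phi -> supported a e phi ->
  cbox a e `<=` Omega ->
  H10 Omega phi (grad phi).
Proof.
move=> sphi Sphi BO; split; first exact: H1_supported BO.
exists (fun=> phi); split.
- by move=> _; exact: supported_test_function BO.
- rewrite (_ : L2norm Omega _ = 0); first exact: cvg_cst.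
  rewrite /L2norm -[RHS]sqrtr0; congr Num.sqrt; rewrite /Rintegral integral0_eq//.
  by move=> x _; rewrite /= subrr expr0n.
- rewrite (_ : vec_L2norm Omega _ = 0); first exact: cvg_cst.
  rewrite /vec_L2norm -[RHS]sqrtr0; congr Num.sqrt; rewrite /Rintegral integral0_eq//.
  by move=> x _; congr EFin; rewrite /= subrr; apply: big1 => i _; rewrite mxE mul0r.
Qed.

(** Each [partial i phi] is itself a test function; inserting it in the definition of the weak
    gradient of v and summing over i gives the identity. *)
Lemma weak_solution_lap a e phi Omega : open Omega -> smooth phi -> supported a e phi ->
  cbox a e `<=` Omega -> weak_solution Omega (fun x => - lap phi x) phi (grad phi).
Proof.
move=> oO sphi Sphi BO; split; first exact: H10_supported BO.
move=> v gv [[vL gvL vgv] _]; have mO := open_measurable_rV oO.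
have S1 i := supported_partial i sphi Sphi.
have S2 i := supported_partial i (smooth_partial i sphi) (S1 i).
have i1 i : mu.-integrable Omega (EFin \o (fun x => gv x ord0 i * partial i phi x)).
  by apply: in_L2_mul_integrable => //; exact: supported_in_L2 BO.
have i2 i : mu.-integrable Omega (EFin \o (fun x => v x * partial i (partial i phi) x)).
  by apply: in_L2_mul_integrable => //; exact: supported_in_L2 BO.
transitivity (\int[mu]_(x in Omega) (\sum_i (gv x ord0 i * partial i phi x))).
  by apply: eq_Rintegral => x _; apply: eq_bigr => i _; rewrite mxE mulrC.
rewrite Rintegral_sum//.
transitivity (- \int[mu]_(x in Omega) (\sum_i (v x * partial i (partial i phi) x)));
  last first.
  rewrite -mulN1r -RintegralZl//; last exact: integrable_Rsum.
  by apply: eq_Rintegral => x _; rewrite -mulr_sumr mulN1r -mulrN mulrC.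
rewrite Rintegral_sum// -sumrN; apply: eq_bigr => i _.
rewrite vgv ?opprK//.
exact: (supported_test_function (smooth_partial i sphi) (S1 i) BO).
Qed.

Lemma continuous_affine c b : continuous (fun x : 'rV[R]_d => dotrv c x + b).
Proof.
move=> x; have h : continuous (fun x : 'rV[R]_d => dotrv c x).
  apply: continuous_big => [|i _ y]; first exact: add_continuous.
  by have := cvgM (@cvg_cst _ (c ord0 i) _ (nbhs y) _)
    (@coord_continuous R 1 d ord0 i y); apply.
by have := cvgD (h x) (@cvg_cst _ b _ (nbhs x) _); apply.
Qed.

Lemma is_derive_affine c b x (i : 'I_d) :
  is_derive x (delta_mx ord0 i) (fun x : 'rV[R]_d => dotrv c x + b) (c ord0 i).
Proof.
apply: (@is_derive_growth _ _ _ _ _ (fun t => c ord0 i * t) _ _ 0 1).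
  move=> h; rewrite opprD addrACA subrr addr0 [h *: _ + 0]addr0 mulr0 subr0;
    apply/eqP; rewrite subr_eq; apply/eqP.
  rewrite /dotrv; under eq_bigr do rewrite !mxE eqxx mulrDr.
  rewrite big_split/= (bigD1 i)//= eqxx big1 ?addr0//.
  by move=> j /negbTE ->; rewrite !mulr0.
apply: (is_derive_eq (is_deriveM (is_derive_cst (c ord0 i) (0 : R) 1)
  (is_derive_id (0 : R) 1))).
by rewrite /GRing.scale/= mulr0 addr0 mulr1.
Qed.

(** With l the affine function, both integrations by parts merge into one: since the i-th partial of
    l is the constant c_i, the product of l with the second partial of phi is the i-th partial of
    [partial i phi * l - c_i * phi]. *)
Lemma Rintegral_lap_affine a e phi c b : smooth phi -> supported a e phi ->
  \int[mu]_x (- lap phi x * (dotrv c x + b)) = 0.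
Proof.
move=> sphi Sphi; set l := fun x : 'rV[R]_d => dotrv c x + b.
have S1 i := supported_partial i sphi Sphi.
have S2 i := supported_partial i (smooth_partial i sphi) (S1 i).
have cl : continuous l := @continuous_affine c b.
pose G i x := partial i (partial i phi) x * l x.
have SG i : supported a e (G i) by exact: (supportedM_l (S2 i)).
transitivity (\int[mu]_x (-1 * \sum_i G i x)).
  by apply: eq_Rintegral => x _; rewrite /G -mulr_suml mulN1r mulNr.
rewrite RintegralZl//; last by apply: (supported_integrable (a := a) (e := e));
  exact: supported_sum.
rewrite Rintegral_sum// => [|i]; last exact: (supported_integrable (SG i)).
rewrite big1 ?mulr0// => i _.
apply: (@Rintegral_partial R d a e i (fun x => partial i phi x * l x +
  (- c ord0 i) * phi x)) => //.
  apply: (@supportedD R d a e (partial i phi \* l) (fun x => - c ord0 i * phi x)).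
    exact: supportedM_l.
  exact: supportedZ.
move=> x.
have D1 := is_deriveM (smooth_is_derive x i (smooth_partial i sphi))
  (is_derive_affine c b x i).
have D2 := is_deriveM (is_derive_cst (- c ord0 i) x (delta_mx ord0 i))
  (smooth_is_derive x i sphi).
apply: (is_derive_eq (is_deriveD D1 D2)); rewrite /GRing.scale/= /G /l.
ring.
Qed.

End smooth.

Section estimates.
Variables (R : realType) (d : nat).
Implicit Types (phi g : 'rV[R]_d -> R) (a : 'rV[R]_d) (e : R) (i : 'I_d).
Local Notation mu := (@lebesgue_rV R d).

(** By continuity g exceeds g(c)/2 near c; comparison with this constant on a half-open box, whose
    measure is explicit and positive, suffices. *)
Lemma Rintegral_gt0 a e g c : supported a e g -> (forall x, 0 <= g x) -> 0 < g c ->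
  0 < \int[mu]_x g x.
Proof.
move=> Sg g0 gc.
have /nbhs_ballP[r /= r0 sub] : nbhs c [set x | g c / 2 < g x].
  by apply: (cvgr_gt _ (Sg.1 c)); rewrite gtr_pMr// invf_lt1// ltr1n.
pose l : 'rV[R]_d := \row_i (c ord0 i - r / 2).
pose u : 'rV[R]_d := \row_i (c ord0 i + r / 2).
pose B := [set x : 'rV[R]_d | forall i, l ord0 i < x ord0 i <= u ord0 i].
have mB : measurable B := measurable_ocbox l u.
have muB : mu B = (\prod_(i < d) (u ord0 i - l ord0 i))%:E.
  by apply: lebesgue_rV_box => i; rewrite !mxE; lra.
have Bg x : B x -> g c / 2 <= g x.
  move=> Bx; apply/ltW/sub/rV_ballP; split => // i.
  have := Bx i; rewrite !mxE distrC ltr_distl => /andP[]; lra.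
have ic : mu.-integrable B (EFin \o (fun=> g c / 2)).
  apply: measurable_bounded_integrable => //; first by rewrite [X in (X < _)%E]muB ltry.
  exact: bounded_cst.
apply: (@lt_le_trans _ _ (\int[mu]_(x in B) (g c / 2))).
  rewrite Rintegral_cst// [X in fine X]muB /= mulr_gt0 ?divr_gt0// prodr_gt0// => i _.
  by rewrite !mxE; lra.
rewrite Rintegral_mkcond; apply: le_Rintegral => //.
- rewrite (_ : _ \o _ = (EFin \o (fun=> g c / 2)) \_ B);
    first (apply/(integrable_mkcond _ mB).1; exact: ic).
  by apply/funext => x /=; rewrite restrict_EFin.
- exact: supported_integrable Sg.
- by move=> x _; rewrite /patch; case: ifPn => // /[!inE] Bx; exact: Bg.
Qed.

(* Integrate [partial i (phi^2 (x_i - a_i))] over the box, where [|x_i - a_i| <= e]. *)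
Lemma poincare a e phi i : 0 <= e -> smooth phi -> supported a e phi ->
  \int[mu]_x (phi x ^+ 2) <= 4 * e ^+ 2 * \int[mu]_x (partial i phi x ^+ 2).
Proof.
move=> e0 sphi Sphi; set p := partial i phi.
have cphi := smooth_continuous sphi.
have Sp : supported a e p := supported_partial i sphi Sphi.
pose l (x : 'rV[R]_d) := dotrv (delta_mx ord0 i) x + - a ord0 i.
have lE x : l x = x ord0 i - a ord0 i.
  rewrite /l /dotrv (bigD1 i)//= big1 ?addr0 ?mxE ?eqxx ?mul1r//.
  by move=> j ij; rewrite mxE eqxx (negbTE ij) mul0r.
have cl : continuous l := @continuous_affine R d _ _.
pose D x := phi x * phi x + 2 * (phi x * (p x * l x)).
have SD : supported a e D.
  apply: (@supportedD R d a e (phi \* phi) (fun x => 2 * (phi x * (p x * l x)))).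
    exact: supportedM_l.
  apply: supportedZ; apply: (@supportedM_r R d a e (p \* l)) => //.
  exact: supportedM_l.
have D0 : \int[mu]_x D x = 0.
  apply: (@Rintegral_partial R d a e i (phi \* (phi \* l))) => //.
    by apply: (@supportedM_r R d a e (phi \* l)) => //; exact: supportedM_l.
  move=> x; have dp := smooth_is_derive x i sphi.
  have dl := is_derive_affine (delta_mx ord0 i) (- a ord0 i) x i.
  apply: (is_derive_eq (is_deriveM dp (is_deriveM dp dl))).
  rewrite -/l -/p mxE !eqxx [(phi * l) x](_ : _ = phi x * l x)// /GRing.scale/= /D.
  by rewrite -/(l x); ring.
have Sphi2 : supported a e (fun x => phi x ^+ 2) := supportedM_l Sphi cphi.
have Sp2 : supported a e (fun x => p x ^+ 2) := supportedM_l Sp Sp.1.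
(* Completing the square: D - phi^2/2 + 2 p^2 l^2 = (phi + 2 p l)^2 / 2 >= 0, and l^2 <= e^2 on the
   cube. *)
have : \int[mu]_x (2^-1 * phi x ^+ 2) <= \int[mu]_x (D x + 2 * e ^+ 2 * p x ^+ 2).
  have SR : supported a e (fun x => D x + 2 * e ^+ 2 * p x ^+ 2).
    by apply: (supportedD SD); exact: supportedZ.
  apply: le_Rintegral => //.
  - exact: (supported_integrable (supportedZ 2^-1 Sphi2)).
  - exact: (supported_integrable SR).
  move=> x _; have [xB|xB] := pselect (cbox a e x); last first.
    by rewrite (SR.2 _ xB) (Sphi.2 _ xB) expr0n mulr0.
  have le : l x ^+ 2 <= e ^+ 2.
    by rewrite -real_normK ?num_real// lerXn2r ?nnegrE// lE; exact: xB.
  have : 0 <= (phi x + 2 * (p x * l x)) ^+ 2 by exact: sqr_ge0.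
  have : p x ^+ 2 * l x ^+ 2 <= p x ^+ 2 * e ^+ 2 by rewrite ler_wpM2l// sqr_ge0.
  rewrite /D; nra.
rewrite RintegralZl//; last exact: (supported_integrable Sphi2).
rewrite RintegralD//;
  [|exact: (supported_integrable SD)|exact: (supported_integrable (supportedZ _ Sp2))].
rewrite RintegralZl//; last exact: (supported_integrable Sp2).
rewrite D0; lra.
Qed.

Lemma supported_dotrv_grad a e phi : smooth phi -> supported a e phi ->
  supported a e (fun x => dotrv (grad phi x) (grad phi x)).
Proof.
move=> sphi Sphi; apply: supported_sum => i.
rewrite (_ : (fun _ => _) = partial i phi \* partial i phi); last first.
  by apply/funext => x; rewrite mxE.
have Sp := supported_partial i sphi Sphi.
exact: supportedM_l Sp.1.
Qed.

Lemma partial_le_grad a e phi i : smooth phi -> supported a e phi ->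
  \int[mu]_x (partial i phi x ^+ 2) <= \int[mu]_x dotrv (grad phi x) (grad phi x).
Proof.
move=> sphi Sphi; have Sp := supported_partial i sphi Sphi.
apply: le_Rintegral => //.
- exact: (supported_integrable (supportedM_l Sp Sp.1)).
- exact: (supported_integrable (supported_dotrv_grad sphi Sphi)).
move=> x _; rewrite /dotrv (bigD1 i)//= mxE -expr2 lerDl.
by apply: sumr_ge0 => j _; rewrite -expr2 sqr_ge0.
Qed.

(** Testing the weak equation on the whole space with phi itself gives G as the integral of
    [- lap phi * phi]. The AM-GM weight 1/(8 e^2) is the one for which Poincare turns the phi^2 term
    into G/2, which the left side absorbs. *)
Lemma grad_le_lap a e phi : (0 < d)%N -> 0 < e -> smooth phi -> supported a e phi ->
  \int[mu]_x dotrv (grad phi x) (grad phi x) <= 4 * e ^+ 2 * \int[mu]_x (lap phi x ^+ 2).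
Proof.
move=> d0 e0 sphi Sphi; pose i := Ordinal d0.
have Sl := supported_lap sphi Sphi.
have cphi := smooth_continuous sphi.
have BT : cbox a e `<=` setT by [].
have /(_ phi (grad phi) (H10_supported sphi Sphi BT)) :=
  (weak_solution_lap openT sphi Sphi BT).2.
set G := Rintegral _ _ _ => GE.
have P := le_trans (poincare i (ltW e0) sphi Sphi)
  (ler_wpM2l _ (partial_le_grad i sphi Sphi)).
have {}P : \int[mu]_x (phi x ^+ 2) <= 4 * e ^+ 2 * G.
  by apply: P; rewrite mulr_ge0// sqr_ge0.
have Sphi2 : supported a e (fun x => phi x ^+ 2) := supportedM_l Sphi cphi.
have Sl2 : supported a e (fun x => lap phi x ^+ 2) := supportedM_l Sl Sl.1.
have c0 : 0 < 2 * e ^+ 2 by rewrite mulr_gt0// exprn_gt0.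
have : G <= \int[mu]_x ((8 * e ^+ 2)^-1 * phi x ^+ 2 + 2 * e ^+ 2 * lap phi x ^+ 2).
  rewrite GE; apply: le_Rintegral => //.
  - by apply: (supported_integrable (a := a) (e := e)); apply: supportedM_l => //;
      exact: supported_oplap.
  - by apply: (supported_integrable (a := a) (e := e)); apply: supportedD;
      exact: supportedZ.
  move=> x _.
  (* AM-GM: [- lap phi * phi <= phi^2 / (8 e^2) + 2 e^2 (lap phi)^2] *)
  rewrite -(ler_pM2l c0) -subr_ge0.
  rewrite [X in 0 <= X](_ : _ = ((2 * e ^+ 2 * lap phi x) + phi x / 2) ^+ 2).
    exact: sqr_ge0.
  by field; rewrite gt_eqF.
rewrite RintegralD//;
  [|exact: (supported_integrable (supportedZ _ Sphi2))|exact: (supported_integrable (supportedZ _ Sl2))].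
rewrite !RintegralZl//;
  [|exact: (supported_integrable Sphi2)|exact: (supported_integrable Sl2)].
move: P; rewrite -(ler_pM2l (x := (8 * e ^+ 2)^-1));
  last by rewrite invr_gt0 mulr_gt0// exprn_gt0.
have -> : (8 * e ^+ 2)^-1 * (4 * e ^+ 2 * G) = G / 2 by field; rewrite gt_eqF.
lra.
Qed.

(** By Poincare a vanishing gradient would force the integral of phi^2 to vanish, against phi(a) >
    0. *)
Lemma grad_gt0 a e phi : (0 < d)%N -> 0 <= e -> smooth phi -> supported a e phi ->
  0 < phi a ->
  0 < \int[mu]_x dotrv (grad phi x) (grad phi x).
Proof.
move=> d0 e0 sphi Sphi pa; pose i := Ordinal d0.
have cphi := smooth_continuous sphi.
have Sphi2 : supported a e (fun x => phi x ^+ 2) := supportedM_l Sphi cphi.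
have : 0 < \int[mu]_x (phi x ^+ 2).
  by apply: (Rintegral_gt0 (c := a) Sphi2) => [x|]; [exact: sqr_ge0|exact: exprn_gt0].
move=> /lt_le_trans /(_ (poincare i e0 sphi Sphi)).
have [-> |h] := eqVneq e 0; first by rewrite expr0n mulr0 mul0r ltxx.
rewrite pmulr_rgt0; last by rewrite mulr_gt0// exprn_gt0// lt_neqAle eq_sym h.
by move=> /lt_le_trans; apply; exact: (partial_le_grad i sphi Sphi).
Qed.

End estimates.

(** * Weak and Galerkin solutions *)

Section energy.
Variables (R : realType) (d : nat) (Omega : set 'rV[R]_d).
Hypothesis oO : open Omega.
Implicit Types (v : 'rV[R]_d -> R) (X Y : 'rV[R]_d -> 'rV[R]_d).
Local Notation mu := (@lebesgue_rV R d).
Local Notation dotL2 X Y := (\int[mu]_(x in Omega) dotrv (X x) (Y x)).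

Let mO : measurable Omega := open_measurable_rV oO.

Lemma integrable_dotrv X Y : vec_in_L2 Omega X -> vec_in_L2 Omega Y ->
  mu.-integrable Omega (EFin \o (fun x => dotrv (X x) (Y x))).
Proof.
move=> XL YL; apply: integrable_Rsum => // i.
exact: (in_L2_mul_integrable mO (XL i) (YL i)).
Qed.

Lemma dotL2C X Y : dotL2 X Y = dotL2 Y X.
Proof. by apply: eq_Rintegral => x _; apply: eq_bigr => i _; rewrite mulrC. Qed.

Lemma dotL2_sqrD X Y (t : R) : vec_in_L2 Omega X -> vec_in_L2 Omega Y ->
  \int[mu]_(x in Omega) dotrv (X x + t *: Y x) (X x + t *: Y x) =
  dotL2 X X + 2 * t * dotL2 X Y + t ^+ 2 * dotL2 Y Y.
Proof.
move=> XL YL.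
have iXX := integrable_dotrv XL XL; have iXY := integrable_dotrv XL YL.
have iYY := integrable_dotrv YL YL.
have iZ (c : R) (h : 'rV[R]_d -> R) : mu.-integrable Omega (EFin \o h) ->
    mu.-integrable Omega (EFin \o (fun x => c * h x)).
  by move=> ih; exact: (integrableZl mO c ih).
rewrite -(RintegralZl _ mO iXY) -(RintegralZl _ mO iYY).
rewrite -(RintegralD mO iXX (iZ _ _ iXY)) -(RintegralD mO _ (iZ _ _ iYY)); last first.
  exact: (integrableD mO iXX (iZ _ _ iXY)).
apply: eq_Rintegral => x _; rewrite /dotrv !mulr_sumr -!big_split/=.
by apply: eq_bigr => i _; rewrite !mxE; ring.
Qed.

(** The degenerate case of Cauchy-Schwarz: a nonnegative function of t that is affine must be
    constant. It removes the cross term of the error when only the energy of [gU] is known to be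
    0. *)
Lemma dotL2_eq0 X Y : vec_in_L2 Omega X -> vec_in_L2 Omega Y ->
  dotL2 Y Y = 0 -> dotL2 X Y = 0.
Proof.
move=> XL YL Y0; apply/eqP/negPn/negP => XY0.
set A := dotL2 X X; set B := dotL2 X Y in XY0.
(* This t makes the squared norm A + 2 t B equal to -1. *)
have := dotL2_sqrD (- (A + 1) / (2 * B)) XL YL; rewrite Y0 mulr0 addr0 -/A -/B.
rewrite (_ : 2 * (- (A + 1) / (2 * B)) * B = - (A + 1)); last by field.
move=> h; have : 0 <= A - (A + 1).
  by rewrite -h; apply: Rintegral_ge0 => x _; apply: sumr_ge0 => i _;
    rewrite -expr2 sqr_ge0.
lra.
Qed.

Variables (a : 'rV[R]_d) (e : R) (phi : 'rV[R]_d -> R).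
Variables (K : set 'rV[R]_d) (M : set (set 'rV[R]_d)).
Hypotheses (sphi : smooth phi) (Sphi : supported a e phi).
Hypotheses (MK : M K) (BK : cbox a e `<=` K `&` Omega).

Let BO : cbox a e `<=` Omega. Proof. by move=> x /BK[]. Qed.
Let BKx : cbox a e `<=` K. Proof. by move=> x /BK[]. Qed.
Let f := fun x => - lap phi x.
Let Sf : supported a e f := supported_oplap sphi Sphi.

Lemma Rintegral_lap_V0 v : V0 Omega M v -> \int[mu]_(x in Omega) (f x * v x) = 0.
Proof.
move=> [_ /(_ K MK)[c [b vE]] _].
rewrite -(@Rintegral_lap_affine R d a e phi c b)//.
rewrite -(@Rintegral_supported _ _ a e (f \* (fun x => dotrv c x + b)) Omega)//; last first.
  by apply: supportedM_l => //; exact: continuous_affine.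
apply: eq_Rintegral => x _ /=.
have [xB|xB] := pselect (cbox a e x); first by rewrite vE//; exact: BKx.
by rewrite Sf.2// !mul0r.
Qed.

Lemma galerkin_solution_lap : galerkin_solution Omega M f (cst 0) (cst 0).
Proof.
have L0 A : in_L2 A (cst 0 : 'rV[R]_d -> R).
  have S0 : supported 0 0 (cst 0 : 'rV[R]_d -> R) by split => //; exact: cst_continuous.
  rewrite /in_L2 (_ : _ \_ _ = cst 0); first exact: supported_Lfun2 S0.
  by apply/funext => x; rewrite /patch; case: ifP.
have R0 (h : 'rV[R]_d -> R) : (forall x, h x = 0) -> \int[mu]_(x in Omega) h x = 0.
  by move=> h0; rewrite /Rintegral integral0_eq// => x _; rewrite h0.
split.
- split => //; first by apply: continuous_subspaceT; exact: cst_continuous.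
  move=> K' _; exists 0, 0 => x _; rewrite addr0 /dotrv big1// => i _.
  by rewrite mxE mul0r.
- split => //.
    by move=> i; rewrite (_ : (fun _ => _) = cst 0)//; apply/funext => x; rewrite mxE.
  move=> psi i _; rewrite !R0 ?oppr0// => x; last by rewrite /= mul0r.
  by rewrite /= mxE mul0r.
- move=> v gv Vv _; rewrite Rintegral_lap_V0// R0// => x.
  by apply: big1 => i _; rewrite mxE mul0r.
Qed.

(* Testing the equations with [u], [phi] and [U] alone gives
   (gu, gu) = (gu, grad phi) = (grad phi, grad phi) and (gU, gU) = 0. *)
Lemma energy_error_lap u gu U gU : weak_solution Omega f u gu ->
  galerkin_solution Omega M f U gU ->
  vec_L2norm Omega (gu \- gU) =
  Num.sqrt (\int[mu]_x dotrv (grad phi x) (grad phi x)).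
Proof.
move=> [H10u wu] [VU HU gU_].
have [Hphi wphi] := weak_solution_lap oO sphi Sphi BO.
have guL : vec_in_L2 Omega gu by case: H10u => -[].
have gUL : vec_in_L2 Omega gU by case: HU.
have gU0 : dotL2 gU gU = 0 by rewrite (gU_ U)// Rintegral_lap_V0.
have guU0 := dotL2_eq0 guL gUL gU0.
have guE : dotL2 gu gu = \int[mu]_x dotrv (grad phi x) (grad phi x).
  rewrite (wu u gu)// -(wphi u gu)// dotL2C (wu phi (grad phi))// -(wphi phi (grad phi))//.
  by rewrite (Rintegral_supported (supported_dotrv_grad sphi Sphi)).
congr Num.sqrt; rewrite -guE.
have := dotL2_sqrD (-1) guL gUL; rewrite guU0 gU0 !mulr0 !addr0 => <-.
by apply: eq_Rintegral => x _ /=; rewrite scaleN1r.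
Qed.

Lemma osc0_lap : finite_set M ->
  diam K * Num.sqrt (\int[mu]_x (lap phi x ^+ 2)) <= osc0 Omega M f.
Proof.
move=> finM.
apply: (le_trans (ler_norm _)); rewrite -sqrtr_sqr.
apply: ler_wsqrtr; rewrite exprMn (fsbigD1 K)//= -[leLHS]addr0 lerD//; last first.
  by apply: fsumr_ge0 => K' _; rewrite mulr_ge0// sqr_ge0.
have mean0 : mean (K `&` Omega) f = 0.
  rewrite /mean (Rintegral_supported Sf BK).
  rewrite (_ : Rintegral _ _ _ = 0) ?mul0r//.
  (* Having mean 0 is orthogonality to the constant 1, an affine function with zero slope. *)
  rewrite -(@Rintegral_lap_affine R d a e phi 0 1)//; apply: eq_Rintegral => x _.
  rewrite /dotrv big1 ?add0r ?mulr1// => i _; by rewrite mxE mul0r.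
rewrite ler_wpM2l ?sqr_ge0// /L2norm mean0.
rewrite ler_sqr ?nnegrE ?sqrtr_ge0// ler_wsqrtr//.
rewrite -(@Rintegral_supported _ _ a e (fun x => lap phi x ^+ 2) (K `&` Omega))//.
  rewrite le_eqVlt; apply/orP; left; apply/eqP; apply: eq_Rintegral => x _.
  by rewrite /= subr0 sqrrN.
have Sl := supported_lap sphi Sphi.
exact: supportedM_l Sl.1.
Qed.

Lemma osc0_error_ratio u gu U gU : finite_set M -> (0 < d)%N -> 0 < e -> 0 < phi a ->
  0 <= diam K ->
  weak_solution Omega f u gu -> galerkin_solution Omega M f U gU ->
  diam K / (2 * e) <= osc0 Omega M f / vec_L2norm Omega (gu \- gU).
Proof.
move=> finM d0 e0 pa diam0 wu gU_; rewrite (energy_error_lap wu gU_).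
(* The error is positive, so the quotient is a genuine one and not the default value 0 of division
   by 0. *)
have G0 := grad_gt0 d0 (ltW e0) sphi Sphi pa.
have GL := grad_le_lap d0 e0 sphi Sphi.
rewrite ler_pdivlMr ?sqrtr_gt0// (le_trans _ (osc0_lap finM))//.
rewrite -mulrA ler_wpM2l// ler_pdivrMl ?mulr_gt0//.
rewrite -[2 * e]ger0_norm ?mulr_ge0 ?(ltW e0)// -sqrtr_sqr -sqrtrM ?sqr_ge0//.
by rewrite ler_wsqrtr// exprMn (_ : 2 ^+ 2 = 4 :> R)//; lra.
Qed.

End energy.

(** * Bumps on shrinking cubes and divergence of the ratio *)

Theorem lemma20 (R : realType) (d : nat) (Omega : set 'rV[R]_d)
    (M : set (set 'rV[R]_d)) :
  (0 < d)%N ->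
  open Omega -> bounded_set Omega -> connected Omega -> Omega !=set0 ->
  conforming_mesh Omega M ->
  exists f : nat -> 'rV[R]_d -> R,
    [/\ forall k, in_L2 Omega (f k),
        forall k, exists u gu U gU,
          weak_solution Omega (f k) u gu /\ galerkin_solution Omega M (f k) U gU &
        forall (u U : nat -> 'rV[R]_d -> R) (gu gU : nat -> 'rV[R]_d -> 'rV[R]_d),
          (forall k, weak_solution Omega (f k) (u k) (gu k)) ->
          (forall k, galerkin_solution Omega M (f k) (U k) (gU k)) ->
          osc0 Omega M (f k) / vec_L2norm Omega (gu k \- gU k) @[k --> \oo]
            --> +oo].
Proof.
move=> d0 oO bO _ O0 mesh.
have [K [a [r [MK r0 BK]]]] := mesh_interior oO O0 mesh.
have [finM _ MO _] := mesh.
have [B OB] := bounded_cbox bO.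
have D0 : 0 < diam K.
  apply: (@diam_gt0 R d K a r B) => //; first by move=> x /BK[].
  (* K lies in the closure of [Omega], hence in the closed cube that contains [Omega]. *)
  move=> x Kx; rewrite [cbox 0 B]((closure_id _).1 (@cbox_closed R d 0 B)).
  by apply: (closureS OB); rewrite -MO; exists K.
pose e k : R := r / k.+1%:R.
have e0 k : 0 < e k by rewrite divr_gt0.
have er k : e k <= r by rewrite ler_pdivrMr// ler_peMr ?(ltW r0)// ler1n.
have [phi phiP] := choice (fun k => exists_bump a (e0 k)).
have sphi k : smooth (phi k) by case: (phiP k).
have pa k : 0 < phi k a by case: (phiP k).
have Sphi k : supported a (e k) (phi k).
  by case: (phiP k) => _ _ h; split => //; exact: smooth_continuous.
have BKk k : cbox a (e k) `<=` K `&` Omega.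
  by move=> x xB; apply: BK => i; exact: le_trans (er k).
have BOk k : cbox a (e k) `<=` Omega by move=> x /BKk[].
exists (fun k x => - lap (phi k) x); split.
- by move=> k; apply: (supported_in_L2 _ (BOk k)); exact: supported_oplap.
- move=> k; exists (phi k), (grad (phi k)), (cst 0), (cst 0); split.
    exact: (weak_solution_lap oO (sphi k) (Sphi k) (BOk k)).
  exact: (galerkin_solution_lap (sphi k) (Sphi k) MK (BKk k)).
move=> u U gu gU wu gU_; apply/cvgryPge => A.
(* The lower bound [diam K / (2 * e k)] equals [diam K * (k + 1) / (2 * r)], so it reaches [A] once
   k + 1 is at least this quotient. *)
have [N hN] : exists N : nat, A * (2 * r) / diam K <= N%:R.
  exists (Num.truncn `|A * (2 * r) / diam K|).+1.
  by rewrite (le_trans (ler_norm _))// ltW// truncnS_gt.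
exists N => // k /= Nk.
apply: le_trans (osc0_error_ratio oO (sphi k) (Sphi k) MK (BKk k) finM d0 (e0 k)
  (pa k) (ltW D0) (wu k) (gU_ k)).
rewrite /e ler_pdivlMr ?mulr_gt0// mulrA mulrA ler_pdivrMr// [leRHS]mulrC -ler_pdivrMr//.
by rewrite (le_trans hN)// ler_nat (leq_trans Nk).
Qed.
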